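(* For $s-q\ge m\ge1$, the spectral bound and the Hadamard bound for the Data-Fusion problem satisfy $$\mathfrak{z}_{\mathcal{S}}-\mathfrak{z}_{\mathcal{H}}\le\sum_{i=s-q+1}^{p}\log\big(d_i(I_p+GB^{-1}G^\top)\big).$$
   Context: Let $G\in\mathbb{R}^{p\times m}$, $H\in\mathbb{R}^{q\times m}$, $B:=H^\top H$ positive definite, $P:=\{1,\dots,p\}$, and $s$ an integer with $0<s-q<p$. The Data-Fusion problem is $\max\{\operatorname{ldet}(B+G^\top\operatorname{Diag}(x)G):\mathbf{e}^\top x=s-q,\ x\in\{0,1\}^p\}$, where $\operatorname{ldet}$ is log-determinant, $\mathbf{e}$ the all-ones vector, $\operatorname{Diag}(x)$ the diagonal matrix with diagonal $x$. For a symmetric matrix $X$, $d_i(X)$ is the $i$-th largest diagonal entry and $\lambda_i(X)$ the $i$-th largest eigenvalue. Spectral bound: $\mathfrak{z}_{\mathcal{S}}:=\operatorname{ldet}(B)+\sum_{i=1}^{s-q}\log\big(1+\lambda_i(GB^{-1}G^\top)\big)$. Hadamard bound: let $LL^\top$ be the Cholesky factorization of $B$, let $\rho_i(GL^{-\top}):=\|G_{i\cdot}L^{-\top}\|_2$ for $i\in P$ ($G_{i\cdot}$ is row $i$ of $G$), and let $\tau$ be a bijection from $\{1,\dots,p\}$ to $P$ such that $\rho_{\tau(i)}(GL^{-\top})\ge\rho_{\tau(j)}(GL^{-\top})$ whenever $i\le j$. Then $\mathfrak{z}_{\mathcal{H}}:=\operatorname{ldet}(B)+\sum_{i=1}^{s-q}\log\big(1+\rho_{\tau(i)}^2(GL^{-\top})\big)$.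 *)

(* Defs.v *)
(* World: MathComp + MathComp-Analysis. *)
From mathcomp Require Import all_boot all_order all_fingroup all_algebra.
From mathcomp Require Import reals exp.
From mathcomp Require polyrcf.

Set Implicit Arguments.
Unset Strict Implicit.
Unset Printing Implicit Defensive.

Import Order.TTheory GRing.Theory Num.Theory.
Local Open Scope ring_scope.

Definition posdefmx (R : realType) (n : nat) (A : 'M[R]_n) : Prop :=
  A^T = A /\ forall x : 'cV[R]_n, x != 0 -> 0 < (x^T *m A *m x) 0 0.

Definition ldet (R : realType) (n : nat) (A : 'M[R]_n) : R := ln (\det A).

(* Real eigenvalues, each repeated according to its multiplicity as a root of
   the characteristic polynomial, largest first. For a symmetric X of order n
   this list has length n. *)
Definition eigenvalues (R : realType) (n : nat) (X : 'M[R]_n) : seq R :=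
  sort >=%R (flatten [seq nseq (mup a (char_poly X)) a
                     | a <- polyrcf.rootsR (char_poly X)]).

(* Indices start at 1: lambda_ X 1 is the largest eigenvalue of X and d_ X 1
   its largest diagonal entry; both are meaningful for 1 <= i <= n only. *)
Definition lambda_ (R : realType) (n : nat) (X : 'M[R]_n) (i : nat) : R :=
  (eigenvalues X)`_i.-1.

Definition d_ (R : realType) (n : nat) (X : 'M[R]_n) (i : nat) : R :=
  (sort >=%R [seq X k k | k <- enum 'I_n])`_i.-1.

(* In MathComp, is_trig_mx means lower triangular. *)
Definition is_cholesky (R : realType) (n : nat) (B L : 'M[R]_n) : Prop :=
  [/\ is_trig_mx L, forall i, 0 < L i i & L *m L^T = B].

Definition rownorm2 (R : realType) (p m : nat) (A : 'M[R]_(p, m)) (i : 'I_p) : R :=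
  Num.sqrt (\sum_j A i j ^+ 2).

(* k is the number of selected rows of G (it is s - q in the bounds for the
   data-fusion problem). *)
Definition spectral_bound (R : realType) (p m : nat) (G : 'M[R]_(p, m))
    (B : 'M[R]_m) (k : nat) : R :=
  ldet B + \sum_(1 <= i < k.+1) ln (1 + lambda_ (G *m invmx B *m G^T) i).

Definition row_ordering (R : realType) (p m : nat) (A : 'M[R]_(p, m))
    (tau : 'S_p) : Prop :=
  forall i j : 'I_p, (i <= j)%N -> rownorm2 A (tau j) <= rownorm2 A (tau i).

(* L is meant to be the Cholesky factor of B (is_cholesky) and tau an ordering
   of the rows of G *m invmx L^T by nonincreasing 2-norm (row_ordering).
   Ordinals start at 0, so the k largest norms are at the positions i < k. *)
Definition hadamard_bound (R : realType) (p m : nat) (G : 'M[R]_(p, m))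
    (B L : 'M[R]_m) (tau : 'S_p) (k : nat) : R :=
  ldet B + \sum_(i < p | (i < k)%N)
             ln (1 + rownorm2 (G *m invmx L^T) (tau i) ^+ 2).

(* Main.v *)
(* Put A = G L^-T, so that G B^-1 G^T = A A^T has the squared row norms of A on
   its diagonal, and the Hadamard bound plus the right-hand side is ldet B plus
   the log of the product of all diagonal entries of I + A A^T. The eigenvalues
   of A A^T are nonnegative, so the sum in the spectral bound is at most
   ldet (I + A A^T), and Hadamard's determinant inequality concludes. *)
Require Import Defs.
From mathcomp Require Import all_boot all_order all_fingroup all_algebra.
From mathcomp Require Import reals sequences exp.
From mathcomp Require Import complex.
From mathcomp Require polyrcf.
Set Implicit Arguments.
Unset Strict Implicit.
Unset Printing Implicit Defensive.

Import Order.TTheory GRing.Theory Num.Theory.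
Local Open Scope ring_scope.

Lemma char_poly_conjmx (F : fieldType) (n : nat) (P D : 'M[F]_n) :
  P \in unitmx -> char_poly (invmx P *m D *m P) = char_poly D.
Proof.
move=> P_unit; rewrite /char_poly.
have -> : char_poly_mx (invmx P *m D *m P) =
    map_mx polyC (invmx P) *m char_poly_mx D *m map_mx polyC P.
  rewrite /char_poly_mx mulmxBr mulmxBl -!map_mxM; congr (_ - _).
  by rewrite scalar_mxC -mulmxA -map_mxM mulVmx// map_mx1 mulmx1.
rewrite !det_mulmx mulrAC -det_mulmx -map_mxM mulVmx//.
by rewrite map_mx1 det1 mul1r.
Qed.

Lemma char_poly_sym_split (R : realType) (n : nat) (M : 'M[R]_n) :
  M^T = M -> exists s : seq R, char_poly M = \prod_(a <- s) ('X - a%:P).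
Proof.
move=> M_sym; pose MC := map_mx (real_complex R) M.
have MC_herm : MC \is hermsymmx.
  apply/is_hermitianmxP; rewrite expr0 scale1r.
  rewrite /MC -[in LHS]M_sym; apply/matrixP => i j.
  by rewrite !mxE [RHS]conjc_real.
have /orthomx_spectralP MC_eq := hermitian_normalmx MC_herm.
have d_real := mxOverP (hermitian_spectral_diag_real MC_herm).
pose d i := spectral_diag MC 0 i.
exists [seq complex.Re (d i) | i <- enum 'I_n].
apply: (map_poly_inj (real_complex R)); rewrite map_prod_XsubC map_char_poly.
rewrite -/MC MC_eq char_poly_conjmx ?spectral_unit//.
rewrite char_poly_trig ?diag_mx_is_trig// big_map big_enum /=.
apply: eq_bigr => i _; rewrite mxE eqxx mulr1n; congr ('X - _%:P).
by rewrite [RHS]RRe_real //; apply: d_real.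
Qed.

Lemma char_poly_eigenvalues (R : realType) (n : nat) (M : 'M[R]_n) :
  M^T = M -> char_poly M = \prod_(a <- eigenvalues M) ('X - a%:P).
Proof.
move=> /char_poly_sym_split[s M_eq]; rewrite M_eq; apply: perm_big.
rewrite perm_sym /eigenvalues perm_sort M_eq.
under eq_map do rewrite mu_prod_XsubC.
apply: perm_trans (perm_count_undup s); apply: perm_flatten; apply: perm_map.
apply: uniq_perm; rewrite ?undup_uniq ?polyrcf.uniq_roots// => x.
rewrite mem_undup -polyrcf.roots_on_rootsR ?in_itv ?root_prod_XsubC//.
by rewrite -M_eq monic_neq0// char_poly_monic.
Qed.

Lemma size_eigenvalues (R : realType) (n : nat) (M : 'M[R]_n) :
  M^T = M -> size (eigenvalues M) = n.
Proof.
move=> /char_poly_eigenvalues /(congr1 (fun p : {poly R} => size p)).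
by rewrite size_char_poly size_prod_XsubC => -[].
Qed.

Lemma det_scalar_add (R : realType) (n : nat) (M : 'M[R]_n) (c : R) :
  M^T = M -> \det (c%:M + M) = \prod_(a <- eigenvalues M) (c + a).
Proof.
move=> M_sym; have n_eq := size_eigenvalues M_sym.
have /(congr1 (fun p : {poly R} => p.[- c])) := char_poly_eigenvalues M_sym.
rewrite -[LHS]/(horner_eval (- c) _) -det_map_mx horner_prod.
have -> : map_mx (horner_eval (- c)) (char_poly_mx M) = - 1 *: (c%:M + M).
  apply/matrixP => i j; rewrite !mxE /horner_eval !hornerE.
  by rewrite hornerMn hornerX mulN1r opprD mulNrn.
under eq_bigr do rewrite hornerXsubC -opprD -mulN1r.
rewrite detZ big_split /= big_const_seq count_predT iter_mulr_1 n_eq.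
by apply: mulfI; rewrite signr_eq0.
Qed.

Lemma trace_eigenvalues (R : realType) (n : nat) (M : 'M[R]_n) :
  M^T = M -> \tr M = \sum_(a <- eigenvalues M) a.
Proof.
move=> M_sym; have := size_eigenvalues M_sym.
case: n => [|n] in M M_sym * => n_eq.
  by rewrite (size0nil n_eq) big_nil /mxtrace big_ord0.
apply: oppr_inj; rewrite -char_poly_trace// char_poly_eigenvalues//.
by rewrite -coefPn_prod_XsubC ?n_eq.
Qed.

Lemma eigenvalue_rayleigh (R : realType) (n : nat) (M : 'M[R]_n) (a : R) :
  M^T = M -> a \in eigenvalues M ->
  exists2 v : 'cV[R]_n, v != 0 & v^T *m M *m v = a *: (v^T *m v).
Proof.
move=> M_sym; rewrite -root_prod_XsubC -char_poly_eigenvalues//.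
rewrite -eigenvalue_root_char => /eigenvalueP[v vM v_neq0].
by exists v^T; rewrite ?trmx_eq0// trmxK vM -scalemxAl.
Qed.

Lemma sqnorm_ge0 (R : realType) (n : nat) (v : 'cV[R]_n) :
  0 <= (v^T *m v) 0 0.
Proof. by rewrite mxE sumr_ge0// => i _; rewrite mxE -expr2 sqr_ge0. Qed.

Lemma sqnorm_gt0 (R : realType) (n : nat) (v : 'cV[R]_n) :
  v != 0 -> 0 < (v^T *m v) 0 0.
Proof.
move=> v_neq0; rewrite lt_def sqnorm_ge0 andbT; apply: contra v_neq0.
rewrite mxE psumr_eq0 => [/allP v0|i _]; last by rewrite mxE -expr2 sqr_ge0.
apply/eqP/colP => i; have := v0 i (mem_index_enum i).
by rewrite !mxE -expr2 sqrf_eq0 => /eqP.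
Qed.

Lemma posdef_eigenvalue_gt0 (R : realType) (n : nat) (M : 'M[R]_n) (a : R) :
  posdefmx M -> a \in eigenvalues M -> 0 < a.
Proof.
move=> [M_sym M_pos] /(eigenvalue_rayleigh M_sym)[v v_neq0 vMv].
by have := M_pos v v_neq0; rewrite vMv mxE pmulr_lgt0// sqnorm_gt0.
Qed.

Lemma gram_eigenvalue_ge0 (R : realType) (p m : nat) (A : 'M[R]_(p, m)) (a : R) :
  a \in eigenvalues (A *m A^T) -> 0 <= a.
Proof.
have AAT_sym : (A *m A^T)^T = A *m A^T by rewrite trmx_mul trmxK.
move=> /(eigenvalue_rayleigh AAT_sym)[v v_neq0 vAv].
have := sqnorm_ge0 (A^T *m v); rewrite trmx_mul trmxK !mulmxA.
rewrite -(mulmxA v^T) vAv mxE.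
by rewrite pmulr_lge0// sqnorm_gt0.
Qed.

Lemma posdef_det_le1 (R : realType) (n : nat) (M : 'M[R]_n) :
  posdefmx M -> \tr M = n%:R -> \det M <= 1.
Proof.
move=> M_pd trM; have [M_sym _] := M_pd.
have -> : \det M = \prod_(a <- eigenvalues M) a.
  have := det_scalar_add 0 M_sym; rewrite raddf0 add0r => ->.
  by apply: eq_bigr => a _; rewrite add0r.
(* AM-GM, through a <= exp (a - 1). *)
have prod_expR : \prod_(a <- eigenvalues M) expR (a - 1) = 1.
  rewrite -expR_sum sumrB -trace_eigenvalues// trM.
  by rewrite big_const_seq count_predT iter_addr_0 size_eigenvalues//
     subrr expR0.
rewrite -[leRHS]prod_expR big_seq [leRHS]big_seq; apply: ler_prod => a a_eig.
rewrite (ltW (posdef_eigenvalue_gt0 M_pd a_eig))/=.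
by have := expR_ge1Dx (a - 1); rewrite subrKC.
Qed.

Lemma posdef_diag_gt0 (R : realType) (n : nat) (M : 'M[R]_n) (i : 'I_n) :
  posdefmx M -> 0 < M i i.
Proof.
move=> [_ /(_ (delta_mx i 0))]; rewrite trmx_delta -rowE -colE !mxE.
apply; apply/eqP => /matrixP/(_ i 0)/eqP.
by rewrite !mxE !eqxx oner_eq0.
Qed.

(* Scaling M to unit diagonal makes its trace n, so that posdef_det_le1
   applies. *)
Lemma hadamard_det_le (R : realType) (n : nat) (M : 'M[R]_n) :
  posdefmx M -> \det M <= \prod_i M i i.
Proof.
move=> M_pd; have Mii_gt0 i := posdef_diag_gt0 i M_pd.
have [M_sym M_pos] := M_pd.
pose c : 'rV[R]_n := \row_i (Num.sqrt (M i i))^-1; pose D := diag_mx c.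
have c_neq0 i : c 0 i != 0 by rewrite mxE invr_eq0 sqrtr_eq0 -ltNge.
have cMc i : c 0 i * M i i * c 0 i = 1.
  by rewrite mxE mulrAC -invfM -expr2 sqr_sqrtr ?ltW// mulVf// gt_eqF.
have D_unit : D \in unitmx.
  by rewrite unitmxE det_diag unitfE; apply/prodf_neq0 => i _.
have DMD_pd : posdefmx (D *m M *m D).
  split=> [|v v_neq0]; first by rewrite !trmx_mul tr_diag_mx M_sym mulmxA.
  have Dv_neq0 : D *m v != 0.
    by apply: contra v_neq0 => /eqP Dv0; rewrite -(mulKmx D_unit v) Dv0 mulmx0.
  by have := M_pos _ Dv_neq0; rewrite trmx_mul tr_diag_mx !mulmxA.
have trDMD : \tr (D *m M *m D) = n%:R.
  rewrite -[in RHS](card_ord n) -sumr_const; apply: eq_bigr => i _.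
  by rewrite mul_mx_diag mul_diag_mx !mxE -[RHS](cMc i) !mxE.
have := posdef_det_le1 DMD_pd trDMD.
rewrite !det_mulmx mulrAC -det_mulmx mulrC.
rewrite -ler_pdivlMr.
  suff -> : (\det (D *m D))^-1 = \prod_i M i i by rewrite mul1r.
  rewrite det_mulmx det_diag -big_split -prodfV /=; apply: eq_bigr => i _.
  by rewrite mxE -invfM -expr2 sqr_sqrtr ?invrK// ltW.
rewrite det_mulmx -expr2 exprn_even_gt0//= det_diag.
by apply/prodf_neq0 => i _.
Qed.

Lemma ln_prod (R : realType) (I : eqType) (s : seq I) (f : I -> R) :
  {in s, forall i, 0 < f i} ->
  ln (\prod_(i <- s) f i) = \sum_(i <- s) ln (f i).
Proof.
move=> f_gt0; apply: expR_inj; rewrite expR_sum lnK.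
  by rewrite big_seq [RHS]big_seq; apply: eq_bigr => i /f_gt0 ?; rewrite lnK.
by rewrite posrE big_seq; apply: prodr_gt0 => i /f_gt0.
Qed.

Lemma gram_add1_posdef (R : realType) (p m : nat) (A : 'M[R]_(p, m)) :
  posdefmx (1%:M + A *m A^T).
Proof.
split=> [|v v_neq0]; first by rewrite linearD /= trmx1 trmx_mul trmxK.
have := sqnorm_ge0 (A^T *m v); rewrite trmx_mul trmxK => Av_ge0.
rewrite mulmxDr mulmx1 mulmxDl mxE ltr_pwDl ?sqnorm_gt0//.
by rewrite -!mulmxA mulmxA.
Qed.

Lemma sum_lambda_le_det (R : realType) (p m k : nat) (A : 'M[R]_(p, m)) :
  (k <= p)%N ->
  \sum_(1 <= i < k.+1) ln (1 + lambda_ (A *m A^T) i) <=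
  ln (\det (1%:M + A *m A^T)).
Proof.
move=> k_le_p; pose X := A *m A^T.
have X_sym : X^T = X by rewrite trmx_mul trmxK.
have ev_ge0 : {in eigenvalues X, forall a, 0 <= a}.
  by move=> a; apply: gram_eigenvalue_ge0.
rewrite det_scalar_add// ln_prod => [|a /ev_ge0 a_ge0]; last first.
  by rewrite ltr_wpDr.
rewrite [leRHS](big_nth 0) -/X size_eigenvalues//.
rewrite (big_cat_nat (leq0n k) k_le_p) big_add1 /=.
rewrite lerDl big_nat_cond sumr_ge0// => i; rewrite andbT => /andP[_ i_lt_p].
by rewrite ln_ge0// lerDl ev_ge0// mem_nth// size_eigenvalues.
Qed.

Lemma d_sorted (R : realType) (p : nat) (M : 'M[R]_p) (tau : 'S_p) :
  (forall i j : 'I_p, (i <= j)%N -> M (tau j) (tau j) <= M (tau i) (tau i)) ->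
  forall i : 'I_p, d_ M i.+1 = M (tau i) (tau i).
Proof.
move=> tau_ord i; pose S := [seq M (tau k) (tau k) | k <- enum 'I_p].
have nthS (l : 'I_p) : nth 0 S l = M (tau l) (tau l).
  by rewrite (nth_map l) ?size_enum_ord// nth_ord_enum.
rewrite /d_ /= -nthS; congr (nth 0 _ i).
apply: (@sorted_eq _ >=%R); first exact: ge_trans.
- exact: ge_anti.
- exact/sort_sorted/ge_total.
- apply/(sortedP 0) => j; rewrite size_map size_enum_ord => j_lt.
  have j_ltW := ltnW j_lt.
  rewrite (nthS (Ordinal j_lt)) (nthS (Ordinal j_ltW)).
  by apply: tau_ord; rewrite /= leqnSn.
rewrite perm_sort [X in perm_eq _ X](map_comp (fun k => M k k) tau).
apply/perm_map/uniq_perm; first exact: enum_uniq.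
  by rewrite map_inj_uniq; [exact: enum_uniq | exact: perm_inj].
by move=> k; rewrite mem_enum inE -(permKV tau k) map_f// mem_enum.
Qed.

Theorem corollary21 (R : realType) (p m q s : nat)
    (G : 'M[R]_(p, m)) (H : 'M[R]_(q, m))
    (B : 'M[R]_m) (B_def : B = H^T *m H) (B_posdef : posdefmx B)
    (sq_gt0 : (0 < s - q)%N) (sq_ltp : (s - q < p)%N)
    (L : 'M[R]_m) (L_chol : is_cholesky B L)
    (tau : 'S_p) (tau_ord : row_ordering (G *m invmx L^T) tau)
    (m_ge1 : (1 <= m)%N) (m_le_sq : (m <= s - q)%N) :
  spectral_bound G B (s - q) - hadamard_bound G B L tau (s - q) <=
  \sum_((s - q).+1 <= i < p.+1) ln (d_ (1%:M + G *m invmx B *m G^T) i).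
Proof.
set A := G *m invmx L^T in tau_ord *.
have [L_trig L_diag LLT] := L_chol.
have L_unit : L \in unitmx.
  by rewrite unitmxE det_trig// unitfE gt_eqF// prodr_gt0.
have GBG : G *m invmx B *m G^T = A *m A^T.
  have -> : invmx B = invmx L^T *m invmx L.
    apply: (canRL (mulKmx _)); first by rewrite unitmx_tr.
    rewrite -[RHS]mulmx1; apply: (canRL (mulKmx L_unit)).
    by rewrite mulmxA LLT mulmxV// -LLT unitmx_mul unitmx_tr L_unit.
  by rewrite /A trmx_mul trmx_inv trmxK !mulmxA.
rewrite /spectral_bound /hadamard_bound -/A GBG.
set k := (s - q)%N in sq_ltp *; set M := 1%:M + A *m A^T.
have M_pd : posdefmx M := gram_add1_posdef A.
have Mii i : M i i = 1 + rownorm2 A i ^+ 2.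
  rewrite /rownorm2 sqr_sqrtr; last by apply: sumr_ge0 => j _; rewrite sqr_ge0.
  rewrite !mxE eqxx; congr (_ + _); apply: eq_bigr => j _.
  by rewrite [A^T _ _]mxE expr2.
have dE : forall i : 'I_p, d_ M i.+1 = M (tau i) (tau i).
  apply: d_sorted => i j /tau_ord ij; rewrite !Mii lerD2l.
  by rewrite ler_sqr// nnegrE sqrtr_ge0.
have hadE : \sum_(i < p | (i < k)%N) ln (1 + rownorm2 A (tau i) ^+ 2) =
    \sum_(0 <= i < k) ln (d_ M i.+1).
  rewrite big_mkord (big_ord_widen _ (fun i => ln (d_ M i.+1)) (ltnW sq_ltp)).
  by apply: eq_bigr => i _; rewrite dE Mii.
have diagE : \sum_(0 <= i < p) ln (d_ M i.+1) = ln (\prod_i M i i).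
  rewrite ln_prod => [|i _]; last exact: posdef_diag_gt0.
  rewrite [RHS](reindex_inj (@perm_inj _ tau)) big_mkord.
  by apply: eq_bigr => i _; rewrite dE.
rewrite opprD addrACA subrr add0r hadE lerBlDl.
rewrite [X in _ + X]big_add1 /=.
rewrite -(big_cat_nat (leq0n k) (ltnW sq_ltp)) /= diagE.
apply: le_trans (sum_lambda_le_det _ (ltnW sq_ltp)) _.
have det_gt0 : 0 < \det M.
  rewrite det_scalar_add; last by rewrite trmx_mul trmxK.
  rewrite big_seq prodr_gt0// => a /gram_eigenvalue_ge0 a_ge0.
  by rewrite ltr_wpDr.
rewrite ler_ln ?posrE ?hadamard_det_le//.
by apply: prodr_gt0 => i _; apply: posdef_diag_gt0.
Qed.
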